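(* Let $k\ge 2$ be an integer and let $b=(2^{k-1}-1)Q+R$ with non-negative integers $Q,R$ and $0\le R\le 2^{k-1}-2$. If $2^{k-1}-2^{k-1-\ell}\le R<2^{k-1}-2^{k-1-(\ell+1)}$ for some integer $\ell$ with $0\le \ell\le k-2$, then $$(2^k-1)Q+R+2^{k-1}-2^{k-1-\ell}\ \le\ m_k(b)\ \le\ (2^k-1)Q+2R,$$ where the lower bound is attained (i.e. $m_k(b)$ equals it) if and only if $R-(2^{k-1}-2^{k-1-\ell})\le k-\ell-2$, and the upper bound is attained if and only if $R=2^{k-1}-2^{k-1-\ell}$.
   Context: Let $\mathbb Z/2=\{0,1\}$ and let $(\ ,\ )$ denote the standard bilinear form (scalar product) on $(\mathbb Z/2)^k$ with values in $\mathbb Z/2$. For an integer $k\ge 2$ and a non-negative integer $b$, $m_k(b)$ is the maximum of $\sum_{v\in(\mathbb Z/2)^k\setminus\{0\}}a_v$ over all families of non-negative integers $(a_v)_{v\in(\mathbb Z/2)^k\setminus\{0\}}$ satisfying the $2^k-1$ inequalities $$\sum_{v\ne 0,\ (u,v)=0}a_v\le b\qquad\text{for each }u\in(\mathbb Z/2)^k\setminus\{0\}.$$ *)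

(* Defs.v *)
From mathcomp Require Import all_boot all_order all_algebra.

Set Implicit Arguments.
Unset Strict Implicit.
Unset Printing Implicit Defensive.

Import GRing.Theory.

Definition dotF2 (k : nat) (u v : 'rV['F_2]_k) : 'F_2 :=
  (\sum_i u 0 i * v 0 i)%R.

(* A family indexed by the nonzero vectors is represented by a function on all
   vectors; its value at 0 is never used. *)
Definition feasible (k b : nat) (a : 'rV['F_2]_k -> nat) : bool :=
  [forall (u : 'rV['F_2]_k | u != 0%R),
    \sum_(v | (v != 0%R) && (dotF2 u v == 0%R)) a v <= b].

Definition total (k : nat) (a : 'rV['F_2]_k -> nat) : nat :=
  \sum_(v | v != 0%R) a v.

(* For 2 <= k every nonzero v is orthogonal to some nonzero u, so a feasible
   family takes values <= b; hence the finite range 'I_b.+1. Lemma max_totalP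
   shows that this is the maximum over all families of natural numbers. *)
Definition max_total (k b : nat) : nat :=
  \max_(a : {ffun 'rV['F_2]_k -> 'I_b.+1} | feasible b (fun v => a v))
    total (fun v => a v).

Lemma feasible_ext k b (a a' : 'rV['F_2]_k -> nat) :
  (forall v, v != 0%R -> a v = a' v) -> feasible b a = feasible b a'.
Proof.
move=> eqa; apply: eq_forallb => u; congr (_ ==> (_ <= _)).
by apply: eq_bigr => v /andP[/eqa].
Qed.

Lemma dotF2_orth k (v : 'rV['F_2]_k) :
  2 <= k -> exists2 u : 'rV['F_2]_k, u != 0%R & dotF2 u v = 0%R.
Proof.
move=> k2; pose i0 : 'I_k := Ordinal (ltnW k2); pose i1 : 'I_k := Ordinal k2.
have dotE (c d : 'F_2) (i j : 'I_k) :
  dotF2 (c *: delta_mx 0 i + d *: delta_mx 0 j)%R v = (c * v 0 i + d * v 0 j)%R.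
  rewrite /dotF2 (eq_bigr (fun l => c * ((l == i)%:R * v 0 l)
    + d * ((l == j)%:R * v 0 l))%R) => [|l _]; last first.
    by rewrite !mxE !eqxx /= mulrDl !mulrA.
  rewrite big_split /= -!mulr_sumr (bigD1 i) //= [in X in (_ + X)%R](bigD1 j) //= !eqxx.
  by rewrite !big1 ?addr0 ?mul1r // => l /negPf ->; rewrite mul0r.
have [v0|v0] := eqVneq (v 0%R i0) 0%R.
  exists (1 *: delta_mx 0 i0 + 0 *: delta_mx 0 i1)%R; last first.
    by rewrite dotE v0 mulr0 mul0r addr0.
  by apply/eqP => /rowP/(_ i0)/eqP; rewrite !mxE eqxx mul0r addr0.
exists (v 0 i1 *: delta_mx 0 i0 + (- v 0 i0) *: delta_mx 0 i1)%R; last first.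
  by rewrite dotE mulNr mulrC subrr.
apply/eqP => /rowP/(_ i1)/eqP; rewrite !mxE !eqxx /= mulr0 add0r mulr1 oppr_eq0.
by rewrite (negPf v0).
Qed.

Lemma feasible_le k b (a : 'rV['F_2]_k -> nat) (v : 'rV['F_2]_k) :
  2 <= k -> feasible b a -> v != 0%R -> a v <= b.
Proof.
move=> k2 /'forall_implyP fa v0; have [u u0 uv] := dotF2_orth v k2.
apply: leq_trans (fa u u0); rewrite (bigD1 v) ?leq_addr //.
by rewrite v0 uv eqxx.
Qed.

Lemma max_totalP k b : 2 <= k ->
  (exists2 a : 'rV['F_2]_k -> nat, feasible b a & total a = max_total k b) /\
  (forall a : 'rV['F_2]_k -> nat, feasible b a -> total a <= max_total k b).
Proof.
move=> k2; split.
  have f0 : feasible b (fun v => [ffun _ : 'rV['F_2]_k => (ord0 : 'I_b.+1)] v).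
    apply/'forall_implyP => u _; rewrite big1 // => v _; by rewrite ffunE.
  have /(eq_bigmax_cond (fun a : {ffun 'rV['F_2]_k -> 'I_b.+1} => total (fun v => a v))) :
    0 < #|[pred a : {ffun 'rV['F_2]_k -> 'I_b.+1} | feasible b (fun v => a v)]|.
    by apply/card_gt0P; exists [ffun=> ord0].
  by case=> a fa ma; exists (fun v => (a v : nat)).
move=> a fa; pose a' := [ffun v : 'rV['F_2]_k => (inord (a v) : 'I_b.+1)].
have aE v : v != 0%R -> a v = a' v.
  by move=> v0; rewrite ffunE inordK // ltnS (feasible_le k2 fa).
have -> : total a = total (fun v => a' v) by apply: eq_bigr => v /aE.
apply: (leq_bigmax_cond (F := fun a : {ffun 'rV['F_2]_k -> 'I_b.+1} => total (fun v => a v))).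
by rewrite -(feasible_ext (a' := fun v => a' v) b aE).
Qed.

(* Main.v *)
(** A family with sum [n] whose hyperplane sums are at most [b] is a binary code
of length [n], dimension [k] and minimum distance at least [d = n - b]; the
Griesmer bound [n >= sum_(i < k) ceil (d / 2^i)] therefore gives both upper
estimates.  Conversely, take [Q + 1] copies of the nonzero vectors, remove a
subspace [V] of dimension [k - l], and add further vectors: arbitrary ones give
the lower bound, and a basis of [V] followed by arbitrary ones beats it by one
as soon as there is room for [k - l - 1] vectors. *)

Require Import Defs.
From mathcomp Require Import all_boot all_order all_algebra.
From mathcomp Require Import zify.

Set Implicit Arguments.
Unset Strict Implicit.
Unset Printing Implicit Defensive.

Import GRing.Theory.

(** * Scalars and dot product over ['F_2] *)

Lemma F2_neq0 (x : 'F_2) : (x != 0)%R = (x == 1%R).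
Proof. by case: x => [[|[|[]]]]. Qed.

Lemma F2_addrr (x : 'F_2) : (x + x = 0)%R.
Proof. by apply: val_inj; case: x => [[|[|[]]]]. Qed.

Section DotProduct.
Local Open Scope ring_scope.
Variable k : nat.
Implicit Types u v w : 'rV['F_2]_k.

Lemma rowF2_addrr v : v + v = 0.
Proof. by apply/rowP => i; rewrite !mxE F2_addrr. Qed.

Lemma dotF2Dr u v w : dotF2 u (v + w) = dotF2 u v + dotF2 u w.
Proof. by rewrite -big_split; apply: eq_bigr => i _; rewrite mxE mulrDr. Qed.

Lemma dotF2C u v : dotF2 u v = dotF2 v u.
Proof. by apply: eq_bigr => i _; rewrite mulrC. Qed.

Lemma dotF2Dl u v w : dotF2 (u + v) w = dotF2 u w + dotF2 v w.
Proof. by rewrite ![dotF2 _ w]dotF2C dotF2Dr. Qed.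

Lemma dotF20 u : dotF2 u 0 = 0.
Proof. by rewrite /dotF2 big1 // => i _; rewrite mxE mulr0. Qed.

Lemma dotF2_delta u i : dotF2 u (delta_mx 0 i) = u 0 i.
Proof.
rewrite /dotF2 (bigD1 i) //= mxE !eqxx mulr1 big1 ?addr0 // => j /negPf ji.
by rewrite mxE ji andbF mulr0.
Qed.

Lemma delta_row_neq0 i : delta_mx 0 i != 0 :> 'rV['F_2]_k.
Proof. by apply/eqP => /rowP/(_ i)/eqP; rewrite !mxE !eqxx. Qed.

End DotProduct.

(** * The Griesmer bound by residual codes *)

Section Griesmer.
Variable k : nat.
Variable a : 'rV['F_2]_k -> nat.
Implicit Types (u v : 'rV['F_2]_k) (W S : {set 'rV['F_2]_k}).

(** Hamming weight of the codeword of [u], where [a v] is the number of positions with column [v]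
    and only columns in [S] are kept. *)
Definition weight S u := \sum_(v in S | dotF2 u v != 0%R) a v.

(** Where [dotF2 u v] is 0, [u'] and [u + u'] agree on [v]; where it is 1, exactly one of them is
    nonzero. *)
Lemma weight_residual S u u' :
  weight S u' + weight S (u + u')%R <=
    weight S u + (weight (S :&: [set v | dotF2 u v == 0%R]) u').*2.
Proof.
rewrite /weight -mul2n big_distrr /= ![\sum_(v in _ | _) _]big_mkcond /=.
rewrite -!big_split /=; apply: leq_sum => v _; rewrite !inE dotF2Dl.
case: (v \in S) => //=; rewrite !F2_neq0.
by case: (dotF2 u v) => [[|[|[]]]] // ?; case: (dotF2 u' v) => [[|[|[]]]] // ? /=;
  rewrite /eq_op /=; lia.
Qed.

(** Iterating [uphalf] i times gives ceil (d / 2^i), so this is the Griesmer sum with [m] terms. *)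
Fixpoint griesmer m d := if m is m'.+1 then d + griesmer m' (uphalf d) else 0.

Lemma leq_griesmer m d d' : d <= d' -> griesmer m d <= griesmer m d'.
Proof.
by elim: m d d' => //= m IHm d d' dd'; rewrite leq_add ?IHm // uphalf_leq.
Qed.

(* The residual code is kept inside the ambient space: [W] plays the role of
   the subspace of functionals already used, [S] of its orthogonal. *)
Lemma griesmer_bound m W S d :
  #|W| * 2 ^ m <= 2 ^ k -> (forall u, u \notin W -> d <= weight S u) ->
  griesmer m d <= \sum_(v in S) a v.
Proof.
elim: m W S d => //= m IHm W S d cW wW.
have [u0 u0W] : exists u, u \notin W.
  apply/existsP; rewrite -negb_forall; apply/negP => /forallP allW.
  have : #|W| = 2 ^ k.
    by rewrite (eq_card (B := predT)) ?card_mx ?card_Fp ?mul1n // => u; rewrite allW.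
  move=> cWk; move: cW; rewrite cWk expnS.
  suff : 2 ^ k * 2 <= 2 ^ k * (2 * 2 ^ m) by have := expn_gt0 2 k; lia.
  by rewrite leq_mul2l; have := expn_gt0 2 m; lia.
(* The residual is taken at a codeword of least weight outside [W]. *)
pose u := [arg min_(u < u0 | u \notin W) weight S u].
have [uW umin] : u \notin W /\ forall u', u' \notin W -> weight S u <= weight S u'.
  by rewrite /u; case: arg_minnP.
(* This at most doubles [W], and for [u'] outside [W'] both [u'] and [u + u'] lie outside [W]. *)
pose W' := W :|: [set (u + w)%R | w in W].
have cW' : #|W'| * 2 ^ m <= 2 ^ k.
  apply: leq_trans cW; rewrite expnS mulnA leq_mul2r; apply/orP; right.
  apply: leq_trans (leq_card_setU _ _) _.
  by rewrite muln2 -addnn leq_add2l leq_imset_card.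
have /(_ (S :&: [set v | dotF2 u v == 0%R])) := IHm W' _ (uphalf d) cW'.
have -> : \sum_(v in S) a v =
    weight S u + \sum_(v in S :&: [set v | dotF2 u v == 0%R]) a v.
  rewrite (bigID (fun v => dotF2 u v != 0%R)) /=; congr addn.
  by apply: eq_bigl => v; rewrite !inE negbK.
move=> IH; apply: leq_add; first exact: wW.
apply: IH => u'; rewrite inE negb_or => /andP[u'W u'uW].
have uu'W : (u + u')%R \notin W.
  apply: contra u'uW => uu'W; apply/imsetP; exists (u + u')%R => //.
  by rewrite addrA rowF2_addrr add0r.
(* Both [u'] and [u + u'] weigh at least as much as [u], so twice the residual weight of [u'] is at
   least [weight S u >= d]. *)
have := weight_residual S u u'; have := umin _ u'W; have := umin _ uu'W.
have := wW u uW; rewrite leq_uphalf_double.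
move: (weight S u) (weight S u') (weight S (u + u')%R) (weight _ u') => p q r s; lia.
Qed.

(** The weight of a nonzero [u] is the total minus a hyperplane sum, hence at least [d]. *)
Lemma feasible_griesmer b d :
  feasible b a -> b + d <= Defs.total a -> griesmer k d <= Defs.total a.
Proof.
move=> /'forall_implyP fa bd.
have -> : Defs.total a = \sum_(v in ~: [set 0%R]) a v.
  by apply: eq_bigl => v; rewrite !inE.
apply: (@griesmer_bound _ [set 0%R]) => [|u]; first by rewrite cards1 mul1n.
rewrite inE => /fa; move: bd; rewrite /Defs.total.
rewrite (bigID (fun v => dotF2 u v == 0%R)) /=.
suff -> : weight (~: [set 0%R]) u = \sum_(v | (v != 0%R) && (dotF2 u v != 0%R)) a v.
  by move=> bd fau; rewrite -(leq_add2l b) (leq_trans bd) ?leq_add2r.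
by apply: eq_bigl => v; rewrite !inE.
Qed.

End Griesmer.

(** * Arithmetic of the Griesmer sum *)

Lemma griesmer_ge m Q e : e < 2 ^ m ->
  (2 ^ m - 1) * Q + e <= griesmer m (uphalf (2 ^ m * Q + e)).
Proof.
elim: m Q e => [|m IHm] Q e em /=; first by rewrite expn0 in em *; lia.
have m0 := expn_gt0 2 m; rewrite expnS in em *.
have -> : uphalf (2 * 2 ^ m * Q + e) = 2 ^ m * Q + uphalf e by lia.
have [e1|e1] := ltnP (uphalf e) (2 ^ m).
  by have := IHm Q _ e1; nia.
(* Here [e] is [2 ^ m.+1 - 1], and rounding up carries into [Q]. *)
have -> : 2 ^ m * Q + uphalf e = 2 ^ m * Q.+1 + 0 by rewrite mulnS; lia.
by have := IHm Q.+1 _ m0; nia.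
Qed.

(** The trailing 1 survives the first [j] halvings and adds 1 to each of those terms. *)
Lemma griesmer_ge_succ m j Q : j <= m ->
  (2 ^ m - 1) * Q + (2 ^ m - 2 ^ j) + j <=
    griesmer m (uphalf (2 ^ m * Q + (2 ^ m - 2 ^ j) + 1)).
Proof.
elim: m j Q => [|m IHm] [|j] Q // jm.
  have := @griesmer_ge m.+1 Q.+1 0 _; rewrite expn_gt0 => /(_ isT).
  have m0 := expn_gt0 2 m.+1.
  have -> : 2 ^ m.+1 * Q.+1 + 0 = 2 ^ m.+1 * Q + (2 ^ m.+1 - 2 ^ 0) + 1 by nia.
  by apply: leq_trans; nia.
have jm' : 2 ^ j <= 2 ^ m by rewrite leq_exp2l.
rewrite !expnS /=.
have -> : uphalf (2 * 2 ^ m * Q + (2 * 2 ^ m - 2 * 2 ^ j) + 1)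
  = 2 ^ m * Q + (2 ^ m - 2 ^ j) + 1 by lia.
by have := IHm j Q jm; have := expn_gt0 2 m; nia.
Qed.

(** [t] halves exactly until it is odd; rounding up then gains a unit that later terms do not
    lose. *)
Lemma griesmer_gt m j Q t : j < m -> 0 < t < 2 ^ j ->
  (2 ^ m - 1) * Q + (2 ^ m - 2 ^ j.+1) + t <
    griesmer m (uphalf (2 ^ m * Q + (2 ^ m - 2 ^ j.+1) + t)).
Proof.
elim: m j Q t => [|m IHm] [|j] Q t // jm; first by rewrite expn0; lia.
rewrite (expnS 2 m) [2 ^ j.+2]expnS /= => t0.
have jm' : 2 ^ j.+1 <= 2 ^ m by rewrite leq_exp2l.
have -> : uphalf (2 * 2 ^ m * Q + (2 * 2 ^ m - 2 * 2 ^ j.+1) + t)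
  = 2 ^ m * Q + (2 ^ m - 2 ^ j.+1) + uphalf t by lia.
have m0 := expn_gt0 2 m.
have jE := expnS 2 j.
have [todd|teven] := boolP (odd t).
  have /(griesmer_ge Q) : 2 ^ m - 2 ^ j.+1 + uphalf t < 2 ^ m by lia.
  by rewrite !addnA; nia.
have := IHm j Q (uphalf t) jm.
have -> : 0 < uphalf t < 2 ^ j by lia.
by move=> /(_ isT); nia.
Qed.

(** * Families with a subspace removed *)

Section Construction.
Variable k : nat.
Implicit Types (u v : 'rV['F_2]_k).

(** Translation by [w] preserves [A] and flips the value of [dotF2 u]. *)
Lemma card_halve (A : {set 'rV['F_2]_k}) u w :
    {in A, forall v, (v + w)%R \in A} -> dotF2 u w != 0%R ->
  #|A| = #|A :&: [set v | dotF2 u v == 0%R]|.*2.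
Proof.
move=> Aw; rewrite F2_neq0 => /eqP uw.
have K v : (v + w + w)%R = v by rewrite -addrA rowF2_addrr addr0.
rewrite -(cardsID [set v | dotF2 u v == 0%R]) -addnn; congr addn.
rewrite -[RHS](card_imset _ (addIr w)); apply: eq_card => v.
rewrite !inE; apply/idP/imsetP => [/andP[uv vA]|[v' /[!inE] /andP[v'A /eqP uv'] ->]].
  exists (v + w)%R => //; rewrite !inE Aw //= dotF2Dr uw.
  by move: uv; rewrite F2_neq0 => /eqP ->.
by rewrite Aw // dotF2Dr uw uv'.
Qed.

Definition coord_space p : {set 'rV['F_2]_k} :=
  [set v : 'rV['F_2]_k | [forall i : 'I_k, (p <= i) ==> (v 0%R i == 0%R)]].

Lemma coord_spaceD p v (i : 'I_k) : i < p -> v \in coord_space p ->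
  (v + delta_mx 0 i)%R \in coord_space p.
Proof.
rewrite !inE => ip /'forall_implyP vp; apply/'forall_implyP => j pj.
rewrite !mxE (eqP (vp j pj)) add0r.
by case: (eqVneq j i) pj => [->|//]; rewrite leqNgt ip.
Qed.

Lemma card_coord_space p : p <= k -> #|coord_space p| = 2 ^ p.
Proof.
elim: p => [_|p IHp pk].
  apply/eqP/cards1P; exists 0%R; apply/setP => v; rewrite !inE.
  apply/'forall_implyP/eqP => [v0|-> i _]; last by rewrite mxE.
  by apply/rowP => i; rewrite mxE; apply/eqP/v0.
(* The coordinate of index [p] halves [coord_space p.+1]; it vanishes exactly on [coord_space p]. *)
pose i := Ordinal pk; pose d : 'rV['F_2]_k := delta_mx 0%R i.
have dd : dotF2 d d != 0%R by rewrite dotF2_delta mxE !eqxx.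
rewrite (card_halve (w := d) (u := d)) //; last by move=> v; apply: coord_spaceD => /=.
rewrite expnS -IHp ?(ltnW pk) // mul2n; congr _.*2.
apply: eq_card => v; rewrite !inE dotF2C dotF2_delta.
apply/andP/'forall_implyP => [[/'forall_implyP vp vi] j|vp].
  by rewrite leq_eqVlt => /orP[/eqP pj|/vp //]; rewrite -(_ : i = j) //; apply: val_inj.
split; last exact: vp.
by apply/'forall_implyP => j /ltnW; apply: vp.
Qed.

Lemma card_coord_space_orth p u (i : 'I_k) : p <= k -> i < p -> u 0%R i != 0%R ->
  #|coord_space p :&: [set v | dotF2 u v == 0%R]| = 2 ^ p.-1.
Proof.
move=> pk ip ui; apply: double_inj.
rewrite -(@card_halve _ u (delta_mx 0%R i)) ?dotF2_delta //; last first.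
  by move=> v; apply: coord_spaceD.
by rewrite card_coord_space // -mul2n -expnS prednK // (leq_ltn_trans _ ip).
Qed.

Lemma coord_spaceT : coord_space k = setT.
Proof.
by apply/setP => v; rewrite !inE; apply/'forall_implyP => i; rewrite leqNgt ltn_ord.
Qed.

Lemma card_orth u : u != 0%R -> #|[set v | dotF2 u v == 0%R]| = 2 ^ k.-1.
Proof.
move=> u0; have [i ui] : exists i, u 0%R i != 0%R.
  apply/existsP; rewrite -negb_forall; apply: contra u0 => /'forall_eqP u0.
  by apply/eqP/rowP => i; rewrite mxE.
by have := card_coord_space_orth (leqnn k) (ltn_ord i) ui; rewrite coord_spaceT setTI.
Qed.

Lemma sum_count_mem (T : finType) (P : pred T) (s : seq T) :
  \sum_(x | P x) count_mem x s = count P s.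
Proof.
elim: s => [|y s IHs] /=; first by rewrite big1.
rewrite big_split /= IHs; congr addn.
rewrite big_mkcond (bigD1 y) //= eqxx big1 ?addn0; first by case: (P y).
by move=> x /negPf xy; rewrite eq_sym xy; case: (P x).
Qed.

Definition punctured Q p s v : nat := Q + (v \notin coord_space p) + count_mem v s.

(** The lone [Q] accounts for the zero vector, counted [Q.+1] times in [Q.+1 * #|A|] and once in the
    intersection. *)
Lemma sum_punctured Q p s (A : {set 'rV['F_2]_k}) : 0%R \in A ->
  \sum_(v | (v != 0%R) && (v \in A)) punctured Q p s v + #|coord_space p :&: A| + Q =
  Q.+1 * #|A| + count (fun v => (v != 0%R) && (v \in A)) s.
Proof.
move=> A0; rewrite -sum_count_mem.
have V0 : 0%R \in coord_space p.
  by rewrite inE; apply/'forall_implyP => i _; rewrite mxE.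
rewrite big_split /= -!sum1_card big_distrr /=.
rewrite [\sum_(v in A) _](bigD1 0%R) //= [\sum_(v in _ :&: _) _](bigD1 0%R) ?in_setI ?V0 ?A0 //=.
have -> : \sum_(v in coord_space p :&: A | v != 0%R) 1 =
  \sum_(v | (v != 0%R) && (v \in A)) (v \in coord_space p).
  rewrite big_mkcond [RHS]big_mkcond /=; apply: eq_bigr => v _; rewrite in_setI.
  by case: (v \in coord_space p); case: (v \in A); case: (v != 0%R).
have -> : \sum_(v in A | v != 0%R) Q.+1 * 1 =
  \sum_(v | (v != 0%R) && (v \in A)) (Q + (v \notin coord_space p)) +
  \sum_(v | (v != 0%R) && (v \in A)) (v \in coord_space p).
  rewrite -big_split /=; apply: eq_big => v; first by rewrite andbC.
  by rewrite muln1; case: (v \in coord_space p); lia.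
set x := \sum_(v | _) (Q + _); set y := \sum_(v | _) count_mem v s.
by set z := \sum_(v | _) (v \in _); lia.
Qed.

Lemma total_punctured Q p s : p <= k -> 0%R \notin s ->
  Defs.total (punctured Q p s) + 2 ^ p + Q = Q.+1 * 2 ^ k + size s.
Proof.
move=> pk s0; have := @sum_punctured Q p s setT (in_setT _).
rewrite setIT card_coord_space // -coord_spaceT card_coord_space // coord_spaceT.
have -> : count (fun v => (v != 0%R) && (v \in setT)) s = size s.
  apply/eqP; rewrite -all_count; apply/allP => v vs.
  by rewrite inE andbT; apply: contraNneq s0 => <-.
by move=> <-; congr (_ + _ + _); apply: eq_bigl => v; rewrite inE andbT.
Qed.

(** If [u] does not vanish on the removed subspace, its hyperplane loses only half of it, and [s]
    must be counted precisely; otherwise all of it is lost and [size s] is a sufficient bound. *)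
Lemma feasible_punctured b Q p s : 0 < p <= k ->
    (forall u (i : 'I_k), i < p -> u 0%R i != 0%R ->
       Q.+1 * 2 ^ k.-1 + count (fun v => dotF2 u v == 0%R) s <= b + 2 ^ p.-1 + Q) ->
    Q.+1 * 2 ^ k.-1 + size s <= b + 2 ^ p + Q ->
  feasible b (punctured Q p s).
Proof.
move=> /andP[p0 pk] fs sb; apply/'forall_implyP => u u0.
have := @sum_punctured Q p s [set v | dotF2 u v == 0%R].
rewrite inE dotF20 eqxx card_orth // => /(_ isT).
have -> : \sum_(v | (v != 0%R) && (v \in [set v | dotF2 u v == 0%R])) punctured Q p s v
  = \sum_(v | (v != 0%R) && (dotF2 u v == 0%R)) punctured Q p s v.
  by apply: eq_bigl => v; rewrite inE.
have -> : count (fun v => (v != 0%R) && (v \in [set v | dotF2 u v == 0%R])) s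
  = count (fun v => (v != 0%R) && (dotF2 u v == 0%R)) s.
  by apply: eq_count => v; rewrite inE.
have [/existsP[i /andP[ip ui]]|noi] := boolP [exists i : 'I_k, (i < p) && (u 0%R i != 0%R)].
  rewrite (card_coord_space_orth pk ip ui); have := fs u i ip ui.
  have : count (fun v => (v != 0%R) && (dotF2 u v == 0%R)) s <=
    count (fun v => dotF2 u v == 0%R) s by apply: sub_count => v /andP[].
  lia.
have -> : coord_space p :&: [set v | dotF2 u v == 0%R] = coord_space p.
  apply/setIidPl/subsetP => v; rewrite !inE => /'forall_implyP vp.
  apply/eqP; rewrite /dotF2 big1 // => i _; have [ip|/vp/eqP ->] := ltnP i p.
    move: noi; rewrite negb_exists => /forallP/(_ i); rewrite ip negbK => /eqP ->.
    by rewrite mul0r.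
  by rewrite mulr0.
rewrite card_coord_space //.
have := count_size (fun v => (v != 0%R) && (dotF2 u v == 0%R)) s; lia.
Qed.

End Construction.

(** * Bounds on the maximum and cases of equality *)

(** For a family of sum [n >= b + d], the leading Griesmer term [n - b] cancels, leaving at most [b]
    for the other terms. *)
Lemma max_total_lt k b d : 2 <= k ->
  b < griesmer k.-1 (uphalf d) -> max_total k b < b + d.
Proof.
move=> k2 bd; have [[a fa <-] _] := max_totalP b k2.
rewrite ltnNge; apply/negP => dt.
have bt : b + (Defs.total a - b) <= Defs.total a by lia.
have := feasible_griesmer fa bt.
have -> : griesmer k (Defs.total a - b) =
    Defs.total a - b + griesmer k.-1 (uphalf (Defs.total a - b)).
  by rewrite -{1}(prednK (ltnW k2)).
have : griesmer k.-1 (uphalf d) <= griesmer k.-1 (uphalf (Defs.total a - b)).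
  by apply/leq_griesmer/uphalf_leq; lia.
lia.
Qed.

Lemma max_total_ge k b Q p (s : seq 'rV['F_2]_k) : 2 <= k ->
    0 < p <= k -> 0%R \notin s ->
    (forall (u : 'rV['F_2]_k) (i : 'I_k), i < p -> u 0%R i != 0%R ->
       Q.+1 * 2 ^ k.-1 + count (fun v => dotF2 u v == 0%R) s <= b + 2 ^ p.-1 + Q) ->
    Q.+1 * 2 ^ k.-1 + size s <= b + 2 ^ p + Q ->
  Q.+1 * 2 ^ k + size s <= max_total k b + 2 ^ p + Q.
Proof.
move=> k2 pk s0 fs sb; have [_ maxk] := max_totalP b k2.
have [_ pk'] := andP pk.
by rewrite -(total_punctured Q pk' s0) !leq_add2r maxk // feasible_punctured.
Qed.

Theorem theorem7p6 (k b Q R l : nat) (hk : 2 <= k)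
  (hb : b = (2 ^ (k - 1) - 1) * Q + R)
  (hR : R <= 2 ^ (k - 1) - 2)
  (hl : l <= k - 2)
  (hRl : 2 ^ (k - 1) - 2 ^ (k - 1 - l) <= R)
  (hRu : R < 2 ^ (k - 1) - 2 ^ (k - 1 - (l + 1))) :
  [/\ (2 ^ k - 1) * Q + R + (2 ^ (k - 1) - 2 ^ (k - 1 - l)) <= max_total k b,
      max_total k b <= (2 ^ k - 1) * Q + 2 * R,
      max_total k b = (2 ^ k - 1) * Q + R + (2 ^ (k - 1) - 2 ^ (k - 1 - l)) <->
        R - (2 ^ (k - 1) - 2 ^ (k - 1 - l)) <= k - l - 2
    & max_total k b = (2 ^ k - 1) * Q + 2 * R <->
        R = 2 ^ (k - 1) - 2 ^ (k - 1 - l)].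
Proof.
(* Thus [j.+2 = k - l] is the dimension of the removed subspace. *)
pose m := k.-1; pose j := (m - l).-1.
have [jm km mE] : [/\ j < m, k = m.+1 & k.-1 = m] by rewrite /j /m; split; lia.
have -> : k - l - 2 = j by rewrite /j /m; lia.
move: hb hR hRl hRu.
have -> : k - 1 - l = j.+1 by rewrite /j /m; lia.
have -> : k - 1 - (l + 1) = j by rewrite /j /m; lia.
have -> : k - 1 = m by rewrite /m; lia.
have kE : 2 ^ k = 2 * 2 ^ m by rewrite km expnS.
set r := 2 ^ m - 2 ^ j.+1 => hb hR hRl hRu.
have jm2 : 2 ^ j.+1 <= 2 ^ m by rewrite leq_exp2l.
have jE : 2 ^ j.+1 = 2 * 2 ^ j by rewrite expnS.
have j2E : 2 ^ j.+2 = 2 * 2 ^ j.+1 by rewrite expnS.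
have j0 := expn_gt0 2 j.
have [t Rt] : exists t, R = r + t by exists (R - r); lia.
have t2 : t < 2 ^ j by lia.
have pk' : j.+2 <= k by lia.
have pk : 0 < j.+2 <= k by [].
pose d0 : 'rV['F_2]_k := delta_mx 0%R (Ordinal (ltnW hk)).
have d00 : d0 != 0%R by apply: delta_row_neq0.
(* A hyperplane not containing the removed subspace has room for exactly [t] further vectors. *)
have lower : (2 ^ k - 1) * Q + R + r <= max_total k b.
  have := @max_total_ge k b Q j.+2 (nseq t d0) hk pk; rewrite mE size_nseq.
  rewrite mem_nseq eq_sym (negPf d00) andbF => /(_ isT) H.
  have {}H := H _ _; suff : Q.+1 * 2 ^ k + t <= max_total k b + 2 ^ j.+2 + Q by nia.
  apply: H => [u i _ _|]; last by nia.
  by have := count_size (fun v => dotF2 u v == 0%R) (nseq t d0); rewrite size_nseq /=; nia.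
have upper : max_total k b <= (2 ^ k - 1) * Q + 2 * R.
  (* [2 ^ m * Q + R] is the claimed bound minus [b]; one more is excluded. *)
  have := @max_total_lt k b (2 ^ m * Q + R.+1) hk; rewrite mE.
  have /(griesmer_ge Q) : R.+1 < 2 ^ m by lia.
  by move=> H /(_ _); nia.
split=> //; split.
- move=> maxE; rewrite leqNgt; apply/negP => jt.
  (* [e] is a basis of the removed subspace. A [u] not vanishing there is non-orthogonal to some
     member of [e], so its hyperplane contains at most [t] of the [t.+1] added vectors. *)
  pose e := [seq delta_mx 0%R (widen_ord pk' i) | i <- enum 'I_j.+2] : seq 'rV['F_2]_k.
  pose s := e ++ nseq (t - j.+1) d0.
  have sizes : size s = t.+1.
    by rewrite size_cat size_map size_enum_ord size_nseq; lia.
  have s0 : 0%R \notin s.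
    rewrite mem_cat mem_nseq eq_sym (negPf d00) andbF orbF.
    by apply/mapP => -[i _ /esym/eqP]; apply/negP/delta_row_neq0.
  have := @max_total_ge k b Q j.+2 s hk pk s0; rewrite mE sizes => H.
  have {}H := H _ _; suff : Q.+1 * 2 ^ k + t.+1 <= max_total k b + 2 ^ j.+2 + Q by nia.
  apply: H => [u i ij ui|]; last by nia.
  suff : count (fun v => dotF2 u v == 0%R) s < t.+1 by rewrite /=; nia.
  rewrite -sizes ltn_neqAle count_size andbT -all_count.
  apply: contra ui => /allP/(_ (delta_mx 0%R i)); rewrite dotF2_delta; apply.
  rewrite mem_cat; apply/orP; left; apply/mapP; exists (Ordinal ij); first by rewrite mem_enum.
  by congr delta_mx; apply: val_inj.
- move=> tj; apply/eqP; rewrite eqn_leq lower andbT.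
  (* [2 ^ m * Q + r] is the lower bound minus [b]; [t <= j] excludes one more. *)
  have := @max_total_lt k b (2 ^ m * Q + r + 1) hk; rewrite mE.
  by have := griesmer_ge_succ Q jm; rewrite -/r => H /(_ _); nia.
- move=> maxE; have [t0|t0] := posnP t; first by lia.
  have := @max_total_lt k b (2 ^ m * Q + r + t) hk; rewrite mE.
  have := @griesmer_gt m j Q t jm; rewrite t0 t2 => /(_ isT).
  by rewrite -/r => H /(_ _); nia.
(* For [R = r] the two bounds coincide. *)
- by move=> Rr; nia.
Qed.
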